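(* Fix $0<c<1$. Let $m,n\to\infty$ with $m/n\to c$, and let $\pi$ be chosen uniformly at random from $\mathrm{PF}(m,n)$. Let $R(\pi)=\#\{i\in\{1,\dots,m-1\}:\pi_i=\pi_{i+1}\}$. Then for every fixed integer $j\ge0$, $$\mathbb P(R(\pi)=j)\to e^{-c}\frac{c^j}{j!}.$$
   Context: $\mathrm{PF}(m,n)$ is the set of sequences $\pi=(\pi_1,\dots,\pi_m)\in\{1,\dots,n\}^m$ such that, when spots $1,\dots,n$ are initially empty and for $i=1,\dots,m$ in turn car $i$ parks in the first empty spot among $\pi_i,\pi_i+1,\dots,n$, every car parks. *)

(* Defs.v *)
From mathcomp Require Import all_boot all_order all_algebra.
From mathcomp Require Import reals.
Set Implicit Arguments.
Unset Strict Implicit.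
Unset Printing Implicit Defensive.
Import GRing.Theory.

Local Open Scope ring_scope.

(* Spots 1, ..., n are represented by 0, ..., n - 1, i.e. by 'I_n. *)

(* [enum 'I_n] is increasing, so the head of the filtered list is the smallest
   spot that qualifies. *)
Definition first_empty (n : nat) (occ : {set 'I_n}) (p : 'I_n) : option 'I_n :=
  ohead [seq s : 'I_n <- enum 'I_n | (p <= s)%N && (s \notin occ)].

Fixpoint all_park (n : nat) (occ : {set 'I_n}) (prefs : seq 'I_n) : bool :=
  if prefs is p :: prefs' then
    if first_empty occ p is Some s then all_park (s |: occ) prefs' else false
  else true.

Definition PF (m n : nat) : {set m.-tuple 'I_n} :=
  [set pi : m.-tuple 'I_n | all_park set0 pi].

(* Both [i] and [i.+1] are below [m] for [i : 'I_m.-1], so neither [onth] is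
   [None]. *)
Definition repeats (m n : nat) (pi : m.-tuple 'I_n) : nat :=
  #|[set i : 'I_m.-1 | onth pi i == onth pi i.+1]|.

(* Probability of the event [E] under the uniform law on [A]; the value is the
   junk 0 when [A] is empty, which for [PF m n] happens only if [n < m]. *)
Definition uniform_pr (R : realType) (T : finType) (A : {set T}) (E : pred T)
  : R :=
  #|[set x in A | E x]|%:R / #|A|%:R.

(* Main.v *)
(* Pollak's circle argument. Close the street into a circle by adding one spot
   between spots n and 1, and let cars wrap around: a preference sequence parks
   on the street iff the extra spot stays empty. Among the rotations of a
   sequence in (Z/(n+1))^m exactly n+1-m leave the extra spot empty, and
   rotating does not change the positions of the repeats, so R has the same law
   on PF(m,n) as on uniform sequences of (Z/(n+1))^m, namely
   Binomial(m-1, 1/(n+1)), which tends to Poisson(c). *)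

Require Import Defs.
From HB Require Import structures.
From mathcomp Require Import all_boot all_order all_algebra.
From mathcomp Require Import all_classical all_reals all_analysis.
Set Implicit Arguments.
Unset Strict Implicit.
Unset Printing Implicit Defensive.
Import Order.TTheory GRing.Theory Num.Theory.
Import numFieldNormedType.Exports.
Local Open Scope ring_scope.

(** * Searching [enum 'I_n] for the least index that satisfies a predicate *)

Lemma ohead_filter_enum_ord (n : nat) (P : pred 'I_n) (k : 'I_n) :
  P k -> (forall i : 'I_n, (i < k)%N -> ~~ P i) ->
  ohead [seq i <- enum 'I_n | P i] = Some k.
Proof.
move=> Pk minP.
have srt : sorted (relpre val ltn) [seq i <- enum 'I_n | P i].
  apply: sorted_filter; first by move=> a b d /=; exact: ltn_trans.
  by rewrite -sorted_map val_enum_ord iota_ltn_sorted.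
have kin : k \in [seq i <- enum 'I_n | P i] by rewrite mem_filter Pk mem_enum.
case E : [seq i <- enum 'I_n | P i] srt kin => [//|h s] /= srt.
have Ph : P h.
  have : h \in [seq i <- enum 'I_n | P i] by rewrite E mem_head.
  by rewrite mem_filter => /andP[].
rewrite inE => /orP[/eqP->//|ks]; congr Some.
have := order_path_min (_ : transitive (relpre val ltn)) srt.
move=> /(_ (fun a b d => @ltn_trans _ _ _))/allP/(_ _ ks) /= hk.
by have := minP _ hk; rewrite Ph.
Qed.

Lemma ohead_filter_enum_ordP (n : nat) (P : pred 'I_n) :
  if ohead [seq i <- enum 'I_n | P i] is Some k
  then P k /\ (forall i : 'I_n, (i < k)%N -> ~~ P i) else forall i, ~~ P i.
Proof.
case: (pickP P) => [i0 Pi0|P0]; last first.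
  rewrite (eq_filter (a2 := pred0)) ?filter_pred0 => [i|i]; first by rewrite P0.
  exact: P0.
case: (arg_minnP (fun i : 'I_n => val i) Pi0) => k Pk mink.
have minP (i : 'I_n) : (i < k)%N -> ~~ P i.
  by move=> ik; apply/negP => /mink; rewrite leqNgt ik.
by rewrite (ohead_filter_enum_ord Pk minP).
Qed.

(** * Parking on the circle ['I_n.+1], with [ord_max] as the added spot *)

Section CircularParking.
Variable n : nat.
Implicit Types (occ : {set 'I_n.+1}) (p d x y : 'I_n.+1)
  (s : seq 'I_n.+1).

(* The junk value is [p] when [occ] is full. *)
Definition circ_spot occ p : 'I_n.+1 :=
  p + odflt 0 (ohead [seq k <- enum 'I_n.+1 | p + k \notin occ]).

Fixpoint circ_park occ s : {set 'I_n.+1} :=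
  if s is p :: s' then circ_park (circ_spot occ p |: occ) s' else occ.

Definition rotate d occ : {set 'I_n.+1} := [set x | x - d \in occ].

(** Since [p <= x], the circular search from [p] reaches [x] before wrapping around, so it agrees
    with the linear search on the street. *)
Lemma circ_spot_eq occ p x : (p <= x)%N -> x \notin occ ->
  (forall y : 'I_n.+1, (p <= y < x)%N -> y \in occ) -> circ_spot occ p = x.
Proof.
move=> px xocc hocc; rewrite /circ_spot.
have val_sub : val (x - p) = (x - p)%N.
  rewrite /= modnDmr addnBA; last exact: ltnW.
  rewrite addnC -addnBA // modnDl modn_small //.
  by rewrite (leq_ltn_trans (leq_subr _ _)).
rewrite (@ohead_filter_enum_ord _ _ (x - p)) /= ?subrKC //.
move=> i; rewrite [X in (_ < X)%N]val_sub ltn_subRL => ix; rewrite negbK.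
have val_add : val (p + i) = (p + i)%N.
  by rewrite /= modn_small // (ltn_trans ix).
by apply: hocc; rewrite [X in (_ <= X < _)%N]val_add leq_addr.
Qed.

Lemma circ_spot_notin occ p : (#|occ| < n.+1)%N -> circ_spot occ p \notin occ.
Proof.
move=> occn; rewrite /circ_spot.
have := ohead_filter_enum_ordP [pred k | p + k \notin occ].
case: ohead => [k [] //|] /= full.
move: occn; rewrite ltnNge -[X in (X <= _)%N]card_ord -cardsT.
rewrite subset_leq_card //.
by apply/fintype.subsetP => x _; have := full (x - p); rewrite negbK subrKC.
Qed.

(** The search sees only offsets from the preferred spot, so it commutes with translations. *)
Lemma circ_spot_rotate d occ p :
  circ_spot (rotate d occ) (p + d) = circ_spot occ p + d.
Proof.
rewrite /circ_spot [RHS]addrAC; congr (_ + odflt _ (ohead _)).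
by apply: eq_filter => k; rewrite inE addrAC addrK.
Qed.

Lemma circ_park_rotate d occ s :
  circ_park (rotate d occ) [seq p + d | p <- s] = rotate d (circ_park occ s).
Proof.
elim: s occ => //= p s IH occ; rewrite circ_spot_rotate -IH; congr circ_park.
by apply/setP => x; rewrite !inE subr_eq.
Qed.

(** The size bound leaves a free spot for every car, so each car occupies a new spot and the junk
    value of [circ_spot] never occurs. *)
Lemma card_circ_park occ s : (#|occ| + size s <= n.+1)%N ->
  #|circ_park occ s| = (#|occ| + size s)%N.
Proof.
elim: s occ => [|p s IH] occ /=; first by rewrite addn0.
move=> le_n.
have nocc : circ_spot occ p \notin occ.
  by apply: circ_spot_notin; apply: leq_trans le_n; rewrite -addSnnS leq_addr.
by rewrite IH cardsU1 nocc add1n addSnnS.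
Qed.

Lemma sub_circ_park occ s : occ \subset circ_park occ s.
Proof.
elim: s occ => //= p s IH occ; apply: fintype.subset_trans (IH _).
exact: finset.subsetUr.
Qed.

Lemma mem_circ_park occ s : {subset s <= circ_park occ s}.
Proof.
elim: s occ => //= p s IH occ x; rewrite inE => /orP[/eqP->|]; last exact: IH.
apply: (fintype.subsetP (sub_circ_park _ _)); rewrite inE.
have [pocc|pocc] := boolP (p \in occ); first by rewrite orbT.
by rewrite inE (@circ_spot_eq _ _ p) ?eqxx // => y; case: leqP => //= /leqNgt.
Qed.

Definition widen1 : 'I_n -> 'I_n.+1 := widen_ord (leqnSn n).

Lemma widen1_inj : injective widen1.
Proof. by move=> x y /(congr1 val) /= ?; apply/val_inj. Qed.

Lemma widen1_neq_max (x : 'I_n) : widen1 x != ord_max.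
Proof. by rewrite -val_eqE /= neq_ltn ltn_ord. Qed.

Lemma neq_max_widen1 y : y != ord_max -> exists x : 'I_n, y = widen1 x.
Proof.
rewrite -val_eqE /= => ym.
have yn : (y < n)%N by have := ltn_ord y; rewrite ltnS leq_eqVlt (negPf ym).
by exists (Ordinal yn); apply/val_inj.
Qed.

(** Both processes agree as long as each car finds a spot on the street. The first car that fails
    there takes [ord_max] on the circle, and that spot then stays occupied. *)
Lemma all_park_circ (occ : {set 'I_n}) (s : seq 'I_n) :
  all_park occ s =
  (ord_max \notin circ_park (widen1 @: occ) (map widen1 s)).
Proof.
have maxNim (A : {set 'I_n}) : ord_max \notin widen1 @: A.
  by apply/imsetP => -[x _ /esym/eqP]; rewrite (negPf (widen1_neq_max x)).
elim: s occ => [|p s IH] occ /=; first by rewrite maxNim.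
rewrite /first_empty.
have := ohead_filter_enum_ordP [pred x : 'I_n | (p <= x)%N && (x \notin occ)].
case: ohead => [x [/= /andP[px xocc] minx]|/= full].
- rewrite (@circ_spot_eq _ _ (widen1 x)) //.
  + by rewrite IH imsetU1.
  + by rewrite mem_imset //; exact: widen1_inj.
  + move=> y /andP[py yx].
    have [z ?] : exists z : 'I_n, y = widen1 z.
      apply: neq_max_widen1.
      by rewrite -val_eqE /= neq_ltn (ltn_trans yx (ltn_ord x)).
    subst y; rewrite mem_imset; last exact: widen1_inj.
    by have := minx _ yx; rewrite py negbK.
- rewrite (@circ_spot_eq _ _ ord_max) //.
  + apply/esym/negbTE; rewrite negbK.
    by apply: (fintype.subsetP (sub_circ_park _ _)); rewrite !inE eqxx.
  + by rewrite /= ltnW.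
  + move=> y /andP[py yx].
    have [z ?] : exists z : 'I_n, y = widen1 z.
      by apply: neq_max_widen1; rewrite -val_eqE /= neq_ltn yx.
    subst y; rewrite mem_imset; last exact: widen1_inj.
    by have := full z; rewrite py negbK.
Qed.

End CircularParking.

(** * Counting sequences by their number of adjacent repeats *)

Fixpoint adj_eq (T : eqType) (x : T) (s : seq T) : nat :=
  if s is y :: s' then (x == y) + adj_eq y s' else 0.

Definition adj_eqs (T : eqType) (s : seq T) : nat :=
  if s is x :: s' then adj_eq x s' else 0.

Lemma adj_eqs_map (T U : eqType) (f : T -> U) (s : seq T) :
  injective f -> adj_eqs (map f s) = adj_eqs s.
Proof.
move=> f_inj; case: s => //= x s.
by elim: s x => //= y s IH x; rewrite IH inj_eq.
Qed.

Lemma repeatsE (m n : nat) (pi : m.-tuple 'I_n) : repeats pi = adj_eqs pi.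
Proof.
rewrite /repeats -sum1dep_card big_mkcond /=.
have := size_tuple pi; move: (tval pi) => s <-.
case: s => [|x s] /=; first by rewrite big_ord0.
elim: s x => [|y s IH] x /=; first by rewrite big_ord0.
by rewrite big_ord_recl IH /=; congr (_ + _)%N.
Qed.

Lemma sum_tupleS (T : finType) (m : nat) (F : seq T -> nat) :
  (\sum_(t : m.+1.-tuple T) F t = \sum_x \sum_(t : m.-tuple T) F (x :: t))%N.
Proof.
rewrite pair_big /=.
rewrite (reindex (fun u : T * m.-tuple T => [tuple of u.1 :: u.2])) //=.
exists (fun t => (thead t, [tuple of behead t])) => [[x t] _|t _] /=.
  by congr pair; apply/val_inj.
by rewrite -tuple_eta.
Qed.

(** Split on the first entry: one value repeats [x], the other [n] do not, and Pascal's rule adds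
    the two cases. The count does not depend on [x], so the induction hypothesis serves every new
    first entry. *)
Lemma sum_adj_eq (n m j : nat) (x : 'I_n.+1) :
  (\sum_(t : m.-tuple 'I_n.+1) (adj_eq x t == j) = 'C(m, j) * n ^ (m - j))%N.
Proof.
elim: m j x => [|m IH] j x.
  rewrite (bigD1 [tuple]) //= big1 ?addn0 => [|t]; last by rewrite tuple0.
  by case: j.
rewrite (sum_tupleS _ (fun s => (adj_eq x s == j) : nat)) (bigD1 x) //= eqxx.
have -> : (\sum_(i < n.+1 | i != x)
    \sum_(t : m.-tuple 'I_n.+1) ((x == i) + adj_eq i t == j)
    = n * ('C(m, j) * n ^ (m - j)))%N.
  rewrite -(@eq_bigr _ _ _ _ _ _ (fun=> 'C(m, j) * n ^ (m - j))%N).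
    by rewrite sum_nat_const -[X in (X * _)%N]/(#|predC1 x|) cardC1 card_ord.
  move=> i; rewrite eq_sym => /negPf->; exact/esym/IH.
case: j => [|j].
  rewrite big1 ?add0n => [|t _]; last by rewrite add1n.
  by rewrite !bin0 !mul1n !subn0 expnS.
rewrite (eq_bigr (fun t : m.-tuple _ => (adj_eq x t == j) : nat))
    => [|t _]; last by rewrite add1n eqSS.
rewrite IH binS mulnDl addnC subSS; congr (_ + _)%N.
(* For [m <= j] the truncated exponents [m - j] and [m - j.+1] are both 0, so no factor [n] splits
   off, but then ['C(m, j.+1)] vanishes. *)
have [jm|mj] := ltnP j m; last by rewrite bin_small ?muln0.
by rewrite -[(m - j)%N](subnSK jm) expnS mulnCA.
Qed.

Lemma card_adj_eqs (n m j : nat) :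
  #|[set t : m.+1.-tuple 'I_n.+1 | adj_eqs t == j]| =
  (n.+1 * ('C(m, j) * n ^ (m - j)))%N.
Proof.
rewrite -sum1dep_card big_mkcond /=.
rewrite (sum_tupleS _ (fun s => if adj_eqs s == j then 1 else 0)%N) /=.
rewrite (eq_bigr (fun=> 'C(m, j) * n ^ (m - j))%N) => [|x _].
  by rewrite sum_nat_const card_ord.
by rewrite -(sum_adj_eq _ _ x); apply: eq_bigr => t _; case: eqP.
Qed.

(** * From the street to the circle, and counting by rotations *)

Lemma card_PF_circ (m n : nat) (E : pred nat) :
  #|[set pi in PF m n | E (adj_eqs pi)]| =
  #|[set t : m.-tuple 'I_n.+1 | (ord_max \notin circ_park finset.set0 t)
                                 && E (adj_eqs t)]|.
Proof.
have inj_map : injective (map_tuple (@widen1 n) : m.-tuple _ -> m.-tuple _).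
  move=> s t /(congr1 val) /= /(inj_map (@widen1_inj n)) ?; exact/val_inj.
rewrite -(card_imset _ inj_map); congr #|pred_of_set _|; apply/setP => t.
rewrite inE; apply/imsetP/andP => [[s]|[tmax Et]].
  rewrite !inE all_park_circ imset0 => /andP[smax Es] -> /=.
  by rewrite smax adj_eqs_map //; exact: widen1_inj.
(* A requested spot always ends up occupied, so no entry of [t] is [ord_max] and every entry lifts
   to the street. *)
have /(_ _)/cid-/all_sig[f Hf] (i : 'I_m) :
    exists x : 'I_n, tnth t i = widen1 x.
  apply: neq_max_widen1; apply: contraNneq tmax => <-.
  by apply: mem_circ_park; exact: mem_tnth.
have tE : t = map_tuple (@widen1 n) [tuple f i | i < m].
  by apply: eq_from_tnth => i; rewrite tnth_map tnth_mktuple.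
exists [tuple f i | i < m] => //.
rewrite !inE all_park_circ imset0; move: tmax Et; rewrite tE /=.
by move=> -> /=; rewrite adj_eqs_map //; exact: widen1_inj.
Qed.

(** Double counting of the pairs of a sequence and a spot that it leaves empty: by rotation every
    spot is left empty equally often, and each sequence leaves exactly [n.+1 - m] spots empty. *)
Lemma card_PF_rotate (m n : nat) (E : pred nat) : (m <= n)%N ->
  (n.+1 * #|[set pi in PF m n | E (adj_eqs pi)]| =
   (n.+1 - m) * #|[set t : m.-tuple 'I_n.+1 | E (adj_eqs t)]|)%N.
Proof.
move=> mn; rewrite card_PF_circ.
pose A := [set t : m.-tuple 'I_n.+1 | E (adj_eqs t)].
pose B v := [set t : m.-tuple 'I_n.+1 | (v \notin circ_park finset.set0 t)
                                 && E (adj_eqs t)].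
have cardB v : #|B v| = #|B ord_max|.
  (* Translation by this [d] carries [v] to [ord_max]. *)
  pose d : 'I_n.+1 := ord_max - v.
  pose f (e : 'I_n.+1) := @map_tuple m _ _ (fun p => p + e).
  have fK e : cancel (f e) (f (- e)).
    by move=> t; apply: eq_from_tnth => i; rewrite !tnth_map addrK.
  rewrite -(card_imset _ (can_inj (fK d))) (can_imset_pre _ (fK d)).
  congr #|pred_of_set _|; apply/setP => t; rewrite !inE /=.
  have rot0 : rotate (- d) finset.set0 = finset.set0.
    by apply/setP => x; rewrite !inE.
  rewrite adj_eqs_map; last exact: addIr.
  by rewrite -rot0 circ_park_rotate rot0 inE opprK subrKC.
have -> : (n.+1 * #|B ord_max| = \sum_v #|B v|)%N.
  by rewrite (eq_bigr (fun=> #|B ord_max|)) // sum_nat_const card_ord.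
transitivity (\sum_(t in A) #|~: circ_park finset.set0 t|)%N.
  rewrite (eq_bigr
    (fun v => \sum_(t in A | v \notin circ_park finset.set0 t) 1)%N).
    rewrite (exchange_big_dep (mem A)) /= => [|v t _ /andP[]//].
    apply: eq_bigr => t tA; rewrite -sum1_card; apply: eq_bigl => v.
    by rewrite tA inE.
  by move=> v _; rewrite -sum1_card; apply: eq_bigl => t; rewrite !inE andbC.
rewrite (eq_bigr (fun=> n.+1 - m)%N) => [|t _].
  by rewrite sum_nat_const mulnC.
rewrite cardsCs finset.setCK card_circ_park cards0 size_tuple; last exact: leqW.
by rewrite [X in (X - _)%N]card_ord.
Qed.

(** The factor [(n.+1 - m) / n.+1] is common to both counts and cancels, being nonzero because
    [m <= n]. What remains is the mass at [j] of Binomial(m-1, 1/(n+1)), over a single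
    denominator. *)
Lemma uniform_pr_PF (R : realType) (m n j : nat) : (0 < m <= n)%N ->
  uniform_pr R (PF m n) (fun pi => repeats pi == j) =
  ('C(m - 1, j) * n ^ (m - 1 - j))%N%:R / n.+1%:R ^+ (m - 1).
Proof.
case: m => // m /= mn; rewrite /uniform_pr subn1 /=.
have -> : [set x in PF m.+1 n | repeats x == j] =
          [set x in PF m.+1 n | pred1 j (adj_eqs x)].
  by apply/setP => x; rewrite !inE repeatsE.
have -> : #|PF m.+1 n| = #|[set x in PF m.+1 n | xpredT (adj_eqs x)]|.
  by apply: eq_card => x; rewrite !inE andbT.
have N0 : (n.+1%:R : R) != 0 by rewrite pnatr_eq0.
have Nm0 : ((n.+1 - m.+1)%N%:R : R) != 0 by rewrite pnatr_eq0 -lt0n subn_gt0.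
have := card_PF_rotate (pred1 j) mn; rewrite /= card_adj_eqs.
have := card_PF_rotate xpredT mn; rewrite cardsT card_tuple card_ord.
set a := #|_|; set b := #|_| => ea eb.
have /(canRL (mulKf N0)) -> : n.+1%:R * a%:R =
    (n.+1 - m.+1)%N%:R * n.+1%:R ^+ m.+1 :> R.
  by rewrite -natrX -!natrM ea.
have /(canRL (mulKf N0)) -> : n.+1%:R * b%:R =
    (n.+1 - m.+1)%N%:R * (n.+1%:R * ('C(m, j) * n ^ (m - j))%N%:R) :> R.
  by rewrite -!natrM eb.
rewrite exprS ![_^-1 * (_ * (_ * _))]mulrCA !(mulKf N0).
by rewrite -mulf_div divff // mul1r.
Qed.

(** * Poisson limit of the binomial law *)

Local Open Scope classical_set_scope.

Section PoissonLimit.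
Variables (R : realType) (c : R) (m n : nat -> nat).
Hypothesis hm : m k @[k --> \oo] --> \oo.
Hypothesis hn : n k @[k --> \oo] --> \oo.
Hypothesis hmn : ((m k)%:R / (n k)%:R : R) @[k --> \oo] --> c.

Lemma cvg_const_div (a : R) : a / (n k)%:R @[k --> \oo] --> (0 : R).
Proof.
rewrite -(mulr0 a); apply: cvgMl_tmp; apply/gtr0_cvgV0; last exact/cvgrnyP.
move/cvgnyPgt: hn => /(_ 0%N); apply: filterS => k; by rewrite ltr0n.
Qed.

Lemma cvg_sub_div (i : nat) :
  ((m k - i)%N%:R / (n k)%:R : R) @[k --> \oo] --> c.
Proof.
rewrite -[c]subr0; apply: cvg_trans (cvgB hmn (cvg_const_div i%:R)).
(* Subtraction in [nat] is truncated; it agrees with the real one once [i <= m k]. *)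
apply: near_eq_cvg; near=> k; rewrite /= natrB ?mulrBl //.
by near: k; move/cvgnyPge: hm; exact.
Unshelve. all: by end_near. Qed.

Lemma cvg_div_succ : ((n k)%:R / (n k).+1%:R : R) @[k --> \oo] --> (1 : R).
Proof.
have h : (1 + 1 / (n k)%:R : R)^-1 @[k --> \oo] --> (1 : R).
  rewrite -[X in _ --> X]invr1; apply: cvgV; first exact: oner_neq0.
  rewrite -[X in _ --> X]addr0; apply: cvgD; first exact: cvg_cst.
  exact: cvg_const_div.
apply: cvg_trans h; apply: near_eq_cvg; near=> k.
have n0 : ((n k)%:R : R) != 0.
  by rewrite pnatr_eq0 -lt0n; near: k; move/cvgnyPgt: hn; exact.
rewrite -[X in X + _](divff n0) -mulrDl invf_div.
by rewrite -[in RHS]natr1.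
Unshelve. all: by end_near. Qed.

Lemma cvg_sub_div_succ (i : nat) :
  ((m k - i)%N%:R / (n k).+1%:R : R) @[k --> \oo] --> c.
Proof.
rewrite -[c]mulr1.
apply: cvg_trans (cvgM (cvg_sub_div i) cvg_div_succ); apply: near_eq_cvg.
near=> k => /=; rewrite mulrA divfK //.
by rewrite pnatr_eq0 -lt0n; near: k; move/cvgnyPgt: hn; exact.
Unshelve. all: by end_near. Qed.

(** The quotient is a product of [j] factors [(m k - i - l) / (n k).+1] with [l < j], each tending
    to [c]. *)
Lemma cvg_ffact_div (i j : nat) :
  (((m k - i) ^_ j)%N%:R / (n k).+1%:R ^+ j : R) @[k --> \oo] --> c ^+ j.
Proof.
elim: j => [|j IH].
  by under eq_fun do rewrite ffactn0 divr1; exact: cvg_cst.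
rewrite exprSr; apply: cvg_trans (cvgM IH (cvg_sub_div_succ (i + j))).
apply: near_eq_cvg; near=> k => /=.
by rewrite ffactnSr natrM subnDA exprSr invfM mulrACA.
Unshelve. all: by end_near. Qed.

(* With [K = m - i], squeeze between [expR (- K / n)] and
   [expR (- K / n.+1)], from
   [1 + x <= expR x] at [x = 1 / n] and at [x = - 1 / n.+1]. *)
Lemma cvg_exprn_expR (i : nat) :
  (((n k)%:R / (n k).+1%:R) ^+ (m k - i) : R) @[k --> \oo] --> expR (- c).
Proof.
have cvg_expR (u : nat -> R) : u k @[k --> \oo] --> c ->
    expR (- u k) @[k --> \oo] --> expR (- c).
  by move=> /cvgN uc; apply: continuous_cvg uc; exact: continuous_expR.
apply: (squeeze_cvgr _ (cvg_expR _ (cvg_sub_div i))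
                       (cvg_expR _ (cvg_sub_div_succ i))).
near=> k.
have n0 : 0 < ((n k)%:R : R).
  by rewrite ltr0n; near: k; move/cvgnyPgt: hn; exact.
have n1 : 0 < ((n k).+1%:R : R) by rewrite ltr0n.
(* Both bounds become powers with exponent [m k - i], so it suffices to compare the bases. *)
rewrite -!mulrN !expRM_natl; apply/andP; split;
  (apply: lerXn2r; rewrite ?nnegrE ?expR_ge0 ?divr_ge0 ?(ltW n0) ?(ltW n1) //).
- rewrite expRN -[leRHS]invf_div lef_pV2 ?posrE ?divr_gt0 ?expR_gt0 //.
  apply: le_trans (expR_ge1Dx _).
  by rewrite -natr1 mulrDl divff ?gt_eqF // mul1r.
- apply: le_trans (expR_ge1Dx _).
  rewrite -[X in X - _](divff (lt0r_neq0 n1)) -[X in X / _ - _]natr1.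
  by rewrite mulrDl mul1r addrK.
Unshelve. all: by end_near. Qed.

(** The mass splits into the power of [n k / (n k).+1] with exponent [m k - 1 - j], which gives
    [expR (- c)], and the falling factorial of [m k - 1] over [(n k).+1 ^+ j] and [j!], which gives
    [c ^+ j / j!]. *)
Lemma cvg_binomial_poisson (j : nat) :
  (('C(m k - 1, j) * n k ^ (m k - 1 - j))%N%:R / (n k).+1%:R ^+ (m k - 1) : R)
    @[k --> \oo] --> expR (- c) * (c ^+ j / j`!%:R).
Proof.
have cvg_prod := cvgM (cvg_exprn_expR (1 + j))
  (cvgMr_tmp (b := j`!%:R^-1) (@cvg_ffact_div 1 j)).
apply: cvg_trans (cvg_prod _ _).
apply: near_eq_cvg; near=> k => /=.
have jm : (j <= m k - 1)%N.
  by rewrite leq_subRL ?addn1; near: k; move/cvgnyPge: hm; exact.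
rewrite -bin_ffact subnDA !natrM natrX.
have -> : (n k).+1%:R ^+ (m k - 1) =
    (n k).+1%:R ^+ (m k - 1 - j) * (n k).+1%:R ^+ j :> R.
  by rewrite -exprD subnK.
rewrite expr_div_n invfM.
rewrite [_ * j`!%:R / _]mulrAC mulfK ?pnatr_eq0 -?lt0n ?fact_gt0 //.
by rewrite mulrACA [_ ^+ _ * _%:R]mulrC.
Unshelve. all: by end_near. Qed.

End PoissonLimit.

Theorem theorem3p19 (R : realType) (c : R) (hc : 0 < c < 1)
  (m n : nat -> nat) (hm : m k @[k --> \oo] --> \oo)
  (hn : n k @[k --> \oo] --> \oo)
  (hmn : ((m k)%:R / (n k)%:R : R) @[k --> \oo] --> c) (j : nat) :
  uniform_pr R (PF (m k) (n k)) (fun pi => repeats pi == j) @[k --> \oo]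
    --> expR (- c) * (c ^+ j / j`!%:R).
Proof.
case/andP: hc => _ c_lt1.
apply: cvg_trans (@cvg_binomial_poisson R c m n hm hn hmn j).
apply: near_eq_cvg; near=> k; rewrite uniform_pr_PF //; apply/andP; split.
  by near: k; move/cvgnyPgt: hm; exact.
have n0 : (0 < n k)%N by near: k; move/cvgnyPgt: hn; exact.
(* Because [c < 1], the ratio [m k / n k] is eventually below 1, which yields [m k <= n k]. *)
rewrite -(ler_nat R) -[leRHS]mul1r -ler_pdivrMr ?ltr0n // ltW //.
by near: k; exact: cvgr_lt c_lt1.
Unshelve. all: by end_near. Qed.
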